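(* Let $f_j(\Delta'_{n,k})$ denote the number of $j$-dimensional faces of the half-open hypersimplex $\Delta'_{n,k}$. Then for all integers $1\le j\le n$, $$ \sum_{k=1}^n f_j(\Delta'_{n,k})=j\cdot 2^{n-j-1}\,\frac{n+j+2}{n+1}\binom{n+1}{j+1}, $$ and for every integer $j\ge1$, with the convention $f_j(\Delta'_{n,k})=0$ when $j>n$, $$ \sum_{n\ge1}\sum_{k=1}^n f_j(\Delta'_{n,k})\,x^n=\frac{j\,x^j(1-x)}{(1-2x)^{j+2}}. $$
   Context: For integers $0<k\le n$, $\Delta_{n,k}=\{(x_1,\ldots,x_n)\in[0,1]^n : k-1\le x_1+\cdots+x_n\le k\}$ (a convex polytope) and the half-open hypersimplex is $\Delta'_{n,k}=\{(x_1,\ldots,x_n)\in[0,1]^n : k-1< x_1+\cdots+x_n\le k\}$. A $j$-face of $\Delta'_{n,k}$ is a set $F\cap\Delta'_{n,k}$ where $F$ is a $j$-dimensional face of $\Delta_{n,k}$ with $F\cap\Delta'_{n,k}\neq\emptyset$; $f_j(\Delta'_{n,k})$ is the number of such sets. *)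

(* Defs.v *)
From HB Require Import structures.
From mathcomp Require Import all_boot all_order all_algebra.
From mathcomp Require Import boolp classical_sets cardinality reals topology normedtype sequences.
Unset Printing Implicit Defensive.
Import Order.TTheory GRing.Theory Num.Theory.
Import numFieldNormedType.Exports.
Local Open Scope classical_set_scope.
Local Open Scope ring_scope.

Section Hypersimplex.
Variable R : realType.

Definition coord_sum {n} (x : 'rV[R]_n) : R := \sum_(i < n) x 0 i.
Definition dotp {n} (a x : 'rV[R]_n) : R := \sum_(i < n) a 0 i * x 0 i.

Definition hypersimplex (n k : nat) : set 'rV[R]_n :=
  [set x : 'rV[R]_n | (forall i, 0 <= x 0 i <= 1) /\
           (k%:R - 1 <= coord_sum x) /\ (coord_sum x <= k%:R)].

Definition half_open_hypersimplex (n k : nat) : set 'rV[R]_n :=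
  [set x : 'rV[R]_n | (forall i, 0 <= x 0 i <= 1) /\
           (k%:R - 1 < coord_sum x) /\ (coord_sum x <= k%:R)].

(* F is a face of the convex polytope P: F = P ∩ {a.x = b} for a valid
   inequality a.x <= b on P (this includes P itself and possibly the empty set) *)
Definition is_face {n} (P F : set 'rV[R]_n) : Prop :=
  exists (a : 'rV[R]_n) (b : R),
    (forall x, P x -> dotp a x <= b) /\
    F = P `&` [set x : 'rV[R]_n | dotp a x = b].

Definition aff_indep {n m} (p : 'I_m.+1 -> 'rV[R]_n) : bool :=
  row_free (\matrix_(i < m) (p (lift ord0 i) - p ord0)).

Definition has_dim {n} (F : set 'rV[R]_n) (j : nat) : Prop :=
  (exists p : 'I_j.+1 -> 'rV[R]_n, (forall i, F (p i)) /\ aff_indep p) /\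
  ~ (exists p : 'I_j.+2 -> 'rV[R]_n, (forall i, F (p i)) /\ aff_indep p).

Definition half_open_faces (j n k : nat) : set (set 'rV[R]_n) :=
  [set G : set 'rV[R]_n | exists F : set 'rV[R]_n, is_face (hypersimplex n k) F /\ has_dim F j /\
           F `&` half_open_hypersimplex n k !=set0 /\
           G = F `&` half_open_hypersimplex n k].

End Hypersimplex.

(* number of elements of a set (0 by convention if the set is infinite) *)
Definition fcount {T : Type} (S : set T) : nat := xget 0%N [set N | (S #= `I_N)%card].

Definition fj (R : realType) (j n k : nat) : nat := fcount (half_open_faces R j n k).

(* Main.v *)
(* A face of the half-open hypersimplex is determined by which of the defining
   inequalities are equalities at its relatively interior points: a set M of
   free coordinates, the set O of coordinates fixed to 1, and whether the sum
   equals k. For j >= 1 the patterns of dimension j are those with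
     - |M| = j,     O disjoint from M, |O| < k <= |O| + j  (sum not fixed), or
     - |M| = j + 1, O disjoint from M, |O| < k <= |O| + j  (sum fixed to k).
   Each pair (M, O) thus occurs for exactly j values of k, so the total is
   j (C(n, j) 2^(n-j) + C(n, j+1) 2^(n-j-1)). The generating function follows
   from sum_n C(n, j) y^n = y^j / (1 - y)^(j+1) at y = 2 x. *)
Require Import Defs.
From mathcomp Require Import all_boot all_order all_algebra.
From mathcomp Require Import boolp classical_sets cardinality reals topology
  normedtype sequences.
From mathcomp Require Import zify lra ring.
Set Implicit Arguments.
Unset Strict Implicit.
Import Order.TTheory GRing.Theory Num.Theory.
Import numFieldNormedType.Exports.
Local Open Scope classical_set_scope.
Local Open Scope ring_scope.

(** * Series of binomial coefficients *)

Section BinomialSeries.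
Variable R : realType.
Implicit Types (x y : R) (j n N : nat).

(** Pascal's rule, summed: the truncated form of the recursion [B_{j+1} = y B_j / (1 - y)] between
    the generating functions of the columns, with the last term as truncation error. *)
Lemma binomial_sum_rec y j N :
  (1 - y) * (\sum_(0 <= n < N) 'C(n, j.+1)%:R * y ^+ n) =
  y * (\sum_(0 <= n < N) 'C(n, j)%:R * y ^+ n) - 'C(N, j.+1)%:R * y ^+ N.
Proof.
elim: N => [|N IH]; first by rewrite !big_geq // bin0n /=; ring.
by rewrite !big_nat_recr //= mulrDr IH binS natrD exprS; ring.
Qed.

(** Induction on [j]: the truncation error in [binomial_sum_rec] is nonnegative, so the limit for
    [j] bounds the increasing partial sums for [j.+1]. *)
Lemma binomial_series_is_cvg y j :
  0 <= y < 1 -> cvgn (series (fun n => 'C(n, j)%:R * y ^+ n : R)).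
Proof.
move=> /andP[y0 y1]; elim: j => [|j IH].
  have -> : (fun n => 'C(n, 0)%:R * y ^+ n : R) = geometric 1 y.
    by apply/funext => n /=; rewrite bin0.
  by apply/cvg_ex; eexists; apply: cvg_geometric_series; rewrite ger0_norm.
have term_ge0 i n : 0 <= 'C(n, i)%:R * y ^+ n :> R.
  by rewrite mulr_ge0 ?ler0n ?exprn_ge0.
have nd i : {homo series (fun n => 'C(n, i)%:R * y ^+ n : R)
               : n m / (n <= m)%N >-> n <= m}.
  by apply: (@nondecreasing_series R _ xpredT 0) => n _ _.
apply: nondecreasing_is_cvgn; first exact: nd.
exists ((1 - y)^-1 * (y * limn (series (fun n => 'C(n, j)%:R * y ^+ n : R)))).
move=> _ [N _ <-]; rewrite -ler_pdivrMl ?invr_gt0 ?subr_gt0 // invrK.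
rewrite /series /= binomial_sum_rec.
have := nondecreasing_cvgn_le (nd j) IH N; rewrite /series /= => le_lim.
by rewrite lerBlDr (le_trans (ler_wpM2l y0 le_lim)) // lerDl.
Qed.

Lemma cvg_binomial_term y j :
  `|y| < 1 -> (fun n => 'C(n, j)%:R * y ^+ n : R) @ \oo --> 0.
Proof.
move=> y1; apply/norm_cvg0P.
have -> : (fun n => `|'C(n, j)%:R * y ^+ n|) =
          (fun n => 'C(n, j)%:R * `|y| ^+ n : R).
  by apply/funext => n; rewrite normrM normrX normr_nat.
by apply: cvg_series_cvg_0; apply: binomial_series_is_cvg; rewrite normr_ge0.
Qed.

(** Passing to the limit in [binomial_sum_rec], starting from the geometric series at [j = 0]. *)
Lemma cvg_binomial_series y j : `|y| < 1 ->
  (fun N => \sum_(0 <= n < N) 'C(n, j)%:R * y ^+ n) @ \oo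
    --> (y ^+ j / (1 - y) ^+ j.+1 : R).
Proof.
move=> y1; have y_lt1 : y < 1 by rewrite (le_lt_trans _ y1) ?ler_norm.
have y_neq1 : 1 - y != 0 by rewrite subr_eq0 gt_eqF.
elim: j => [|j IH].
  rewrite expr0 expr1.
  have -> : (fun N => \sum_(0 <= n < N) 'C(n, 0)%:R * y ^+ n) =
            series (geometric 1 y).
    by apply/funext => N; apply: eq_bigr => n _ /=; rewrite bin0.
  exact: cvg_geometric_series.
have -> : (fun N => \sum_(0 <= n < N) 'C(n, j.+1)%:R * y ^+ n) =
  (fun N => (1 - y)^-1 * (y * (\sum_(0 <= n < N) 'C(n, j)%:R * y ^+ n)
                          - 'C(N, j.+1)%:R * y ^+ N)).
  by apply/funext => N; rewrite -binomial_sum_rec mulKf.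
have -> : y ^+ j.+1 / (1 - y) ^+ j.+2 =
          (1 - y)^-1 * (y * (y ^+ j / (1 - y) ^+ j.+1) - 0).
  by rewrite [in LHS]exprS [(1 - y) ^+ j.+2]exprS; field; rewrite expf_neq0.
apply: cvgMr; apply: cvgB; first exact: cvgMr.
exact: cvg_binomial_term.
Qed.

End BinomialSeries.

(** * Dimension of a set with a prescribed direction space *)

Section Geometry.
Variable R : realType.

Section AffineDimension.
Variable n : nat.
Implicit Types (F : set 'rV[R]_n) (x v : 'rV[R]_n) (W : 'M[R]_n).

Definition has_indep F (m : nat) : Prop :=
  exists p : 'I_m.+1 -> 'rV[R]_n, (forall i, F (p i)) /\ aff_indep R p.

(** Differences of points of [F] lie in [W], which bounds [m]; conversely, short steps from [x0]
    along [m] independent vectors of [W] stay in [F]. *)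
Lemma has_indep_rank F x0 W m :
  F x0 -> (forall x, F x -> (x - x0 <= W)%MS) ->
  (forall v, (v <= W)%MS -> exists2 e : R, 0 < e & F (x0 + e *: v)) ->
  has_indep F m <-> (m <= \rank W)%N.
Proof.
move=> Fx0 FW WF; split.
  move=> [p [Fp]]; rewrite /aff_indep /row_free => /eqP <-.
  apply: mxrankS; apply/row_subP => i; rewrite rowK.
  have -> : p (lift ord0 i) - p ord0 = (p (lift ord0 i) - x0) - (p ord0 - x0).
    by rewrite opprB addrA subrK.
  by rewrite addmx_sub ?eqmx_opp ?FW.
move=> le_mW; pose B := (pid_mx m : 'M_(m, \rank W)) *m row_base W.
have Bfree : \rank B = m by rewrite mxrankMfree ?row_base_free ?rank_pid_mx.
have BW i : (row i B <= W)%MS.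
  by rewrite row_mul (submx_trans (submxMl _ _)) ?eq_row_base.
pose e i := s2val (cid2 (WF _ (BW i))).
have e_gt0 i : 0 < e i by rewrite /e; case: cid2.
have Fe i : F (x0 + e i *: row i B) by rewrite /e; case: cid2.
exists (fun i => oapp (fun i => x0 + e i *: row i B) x0 (unlift ord0 i)).
split=> [i|]; first by case: unliftP => [j|] _ /=.
rewrite /aff_indep /row_free; set D := (X in \rank X).
(* The differences are the rows of [B] scaled by positive step lengths, so the rank is that of
   [B]. *)
have -> : D = diag_mx (\row_i e i) *m B.
  apply/row_matrixP => i; rewrite rowK liftK unlift_none /= addrC addKr.
  by apply/rowP => l; rewrite mul_diag_mx !mxE.
have De : row_full (diag_mx (\row_i e i)).
  rewrite row_full_unit unitmxE det_diag unitfE; apply/prodf_neq0 => i _.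
  by rewrite mxE gt_eqF.
by rewrite (eqmxMfull B De) Bfree.
Qed.

Lemma has_dim_rank F x0 W j :
  F x0 -> (forall x, F x -> (x - x0 <= W)%MS) ->
  (forall v, (v <= W)%MS -> exists2 e : R, 0 < e & F (x0 + e *: v)) ->
  has_dim R F j <-> j = \rank W.
Proof.
move=> Fx0 FW WF; have indepP m := has_indep_rank m Fx0 FW WF.
split=> [[/indepP ? nindep]|->].
  apply/eqP; rewrite eqn_leq; apply/andP; split=> //.
  by rewrite leqNgt; apply/negP => /indepP.
by split; [exact/indepP | move/indepP; rewrite ltnn].
Qed.

End AffineDimension.

(** * Faces of the half-open hypersimplex *)

Section Strata.
Variables n k : nat.
Implicit Types (x y v : 'rV[R]_n) (M : {set 'I_n}) (t : bool).
Local Notation P := (hypersimplex R n k).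
Local Notation H := (half_open_hypersimplex R n k).
Local Notation face_pattern := ({set 'I_n} * {set 'I_n} * bool)%type.

Lemma coord_sumD x y : coord_sum R (x + y) = coord_sum R x + coord_sum R y.
Proof. by rewrite -big_split; apply: eq_bigr => i _; rewrite mxE. Qed.

Lemma coord_sumZ (a : R) x : coord_sum R (a *: x) = a * coord_sum R x.
Proof. by rewrite /coord_sum mulr_sumr; apply: eq_bigr => i _; rewrite mxE. Qed.

Lemma coord_sumB x y : coord_sum R (x - y) = coord_sum R x - coord_sum R y.
Proof. by rewrite -scaleN1r coord_sumD coord_sumZ mulN1r. Qed.

Lemma dotpD (a x y : 'rV[R]_n) : dotp R a (x + y) = dotp R a x + dotp R a y.
Proof.
by rewrite -big_split; apply: eq_bigr => i _; rewrite mxE mulrDr.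
Qed.

Lemma dotpZ (a : R) (b x : 'rV[R]_n) : dotp R b (a *: x) = a * dotp R b x.
Proof.
by rewrite /dotp mulr_sumr; apply: eq_bigr => i _; rewrite mxE mulrCA.
Qed.

(** Row space of the vectors supported on [M], with zero coordinate sum if [t] holds. For
    [t = false] the kernel is that of the zero map, hence no condition. *)
Definition direction M t : 'M[R]_n :=
  (rowsub (enum_val : 'I_#|M| -> 'I_n) 1%:M
   :&: kermx (const_mx t%:R : 'M_(n, 1)))%MS.

Lemma mul_ones v (a : R) :
  v *m (const_mx a : 'M_(n, 1)) = (coord_sum R v * a)%:M.
Proof.
apply/matrixP => i j; rewrite !mxE !ord1 eqxx mulr1n /coord_sum mulr_suml.
by apply: eq_bigr => l _; rewrite mxE.
Qed.

Lemma sub_directionP M t v :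
  reflect ((forall i, i \notin M -> v 0 i = 0) /\ (t -> coord_sum R v = 0))
          (v <= direction M t)%MS.
Proof.
rewrite sub_capmx; apply: (iffP andP) => [[/submxP[u vE] /sub_kermxP]|[vM vt]].
  rewrite mul_ones => /matrixP /(_ 0 0); rewrite !mxE mulr1n => st; split.
    move=> i iM; rewrite vE mxE big1 // => l _; rewrite !mxE.
    case: eqP => [lE|_]; last by rewrite mulr0.
    by rewrite -lE enum_valP in iM.
  by move=> tT; move: st; rewrite tT mulr1.
split; last first.
  apply/sub_kermxP; rewrite mul_ones; case: t vt => [->//|_].
    by rewrite mul0r raddf0.
  by rewrite mulr0 raddf0.
apply/submxP; exists (colsub enum_val v); apply/rowP => l; rewrite !mxE.
under eq_bigr do rewrite !mxE.
rewrite -(@big_enum_val _ _ _ _ (mem M) (fun i => v 0 i * (i == l)%:R)) /=.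
have [lM|lM] := boolP (l \in M).
  rewrite (bigD1 l) //= eqxx mulr1 big1 ?addr0 // => i /andP[_ /negPf ->].
  by rewrite mulr0.
rewrite vM // big1 // => i iM; case: eqP => [il|_]; last by rewrite mulr0.
by rewrite -il iM in lM.
Qed.

(** Rank-nullity for the coordinate sum on vectors supported on [M]. If [M] is empty, truncated
    subtraction gives the correct value 0. *)
Lemma rank_direction M t : \rank (direction M t) = (#|M| - t)%N.
Proof.
set A := rowsub (enum_val : 'I_#|M| -> 'I_n) (1%:M : 'M[R]_n).
have rA : \rank A = #|M|.
  apply/eqP; apply/row_freeP; exists A^T.
  apply/matrixP => i j; rewrite !mxE (bigD1 (enum_val i)) //= !mxE eqxx mul1r.
  rewrite big1 ?addr0 => [|l /negPf li]; first last.
    by rewrite !mxE eq_sym li mul0r.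
  by rewrite eq_sym (inj_eq enum_val_inj).
have := mxrank_mul_ker A (const_mx t%:R : 'M_(n, 1)).
rewrite rA -/(direction M t); set r := \rank (A *m _).
case: t @r => r rankE; last first.
  suff r0 : r = 0 by rewrite -rankE r0 add0n subn0.
  by rewrite /r (_ : const_mx _ = 0) ?mulmx0 ?mxrank0 //.
have [M0|[i iM]] := set_0Vmem M.
  move: rankE; rewrite M0 finset.cards0 => /eqP.
  by rewrite addn_eq0 => /andP[_ /eqP].
suff r1 : r = 1 by rewrite -rankE r1 addKn.
apply/eqP; rewrite eqn_leq rank_leq_col lt0n mxrank_eq0.
apply/eqP => /matrixP /(_ (enum_rank_in iM i) 0); rewrite !mxE.
under eq_bigr do rewrite !mxE mulr1 enum_rankK_in //.
rewrite (bigD1 i) //= eqxx big1 ?addr0 => [/eqP|l /negPf li].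
  by rewrite oner_eq0.
by rewrite eq_sym li.
Qed.

Definition free_coords x : {set 'I_n} := [set i | 0 < x 0 i < 1]%SET.
Definition one_coords x : {set 'I_n} := [set i | x 0 i == 1]%SET.

(* On the half-open hypersimplex the facet [sum = k - 1] is never tight, so this
   triple records exactly the inequalities that are equalities at [x]. *)
Definition pattern x : face_pattern :=
  (free_coords x, one_coords x, coord_sum R x == k%:R).

Definition pattern_dim (p : face_pattern) : nat :=
  (#|p.1.1| - p.2)%N.

(** Only the tight constraints are imposed; free coordinates may still reach 0 or 1. This gives a
    whole closed face, not its relative interior. *)
Definition stratum (p : face_pattern) : set 'rV[R]_n :=
  [set x | P x /\ (forall i, i \notin p.1.1 -> x 0 i = (i \in p.1.2)%:R)
               /\ (p.2 -> coord_sum R x = k%:R)].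

Lemma half_openE x : H x <-> P x /\ k%:R - 1 < coord_sum R x.
Proof.
split=> [[x01 [lo hi]]|[[x01 [_ hi]] lo]]; last by [].
by split=> //; split=> //; split=> //; exact: ltW.
Qed.

Lemma not_freeE x i : P x -> i \notin free_coords x ->
  x 0 i = (i \in one_coords x)%:R.
Proof.
move=> [/(_ i)/andP[x0 x1] _]; rewrite !inE negb_and -!leNgt.
case/orP=> h; last by rewrite (_ : x 0 i = 1) ?eqxx //; apply/le_anti/andP.
rewrite (_ : x 0 i = 0) ?[0 == 1]eq_sym ?oner_eq0 //; apply/le_anti/andP.
by split.
Qed.

Lemma stratum_pattern x : P x -> stratum (pattern x) x.
Proof.
by move=> Px; split=> //; split=> [i|/eqP //]; exact: not_freeE.
Qed.

(** A positive slack [s] absorbs every step shorter than [s / |w|]; a zero slack does not move at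
    all. *)
Lemma slack_near (s w : R) : 0 <= s -> (s = 0 -> w = 0) ->
  \forall e \near 0^'+, 0 <= s + e * w.
Proof.
move=> s_ge0 sw; have [w0|w_neq0] := eqVneq w 0.
  by near=> e; rewrite w0 mulr0 addr0.
have s_gt0 : 0 < s by rewrite lt_def s_ge0 andbT; apply: contra_neq w_neq0.
near=> e.
have e_gt0 : 0 < e by near: e; exact: nbhs_right_gt.
have : e < s / `|w|.
  by near: e; apply: nbhs_right_lt; rewrite divr_gt0 ?normr_gt0.
rewrite ltr_pdivlMr ?normr_gt0 // => /ltW; rewrite -lerN2 => le_s.
rewrite -lerBlDl sub0r (le_trans le_s) // -mulrN ler_pM2l //.
by rewrite lerNl ler_normr lexx orbT.
Unshelve. all: by end_near. Qed.

(** Each of the finitely many inequalities is either tight at [x] and preserved by [v], or has room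
    for a short step. The bound [k - 1] is strict on [H], so it puts no condition on [v]. *)
Lemma perturb x v : H x -> (forall i, i \notin free_coords x -> v 0 i = 0) ->
  (coord_sum R x = k%:R -> coord_sum R v = 0) ->
  exists2 e : R, 0 < e & P (x + e *: v).
Proof.
move=> [x01 [lo hi]] vM vt.
have F0 : \forall e \near 0^'+, forall i, 0 <= x 0 i + e * v 0 i.
  apply: filter_forall => i; have /andP[x0 _] := x01 i.
  by apply: slack_near => // xi; rewrite vM // inE xi ltxx.
have F1 : \forall e \near 0^'+, forall i, 0 <= (1 - x 0 i) + e * - v 0 i.
  apply: filter_forall => i; have /andP[_ x1] := x01 i.
  apply: slack_near; first by rewrite subr_ge0.
  move/eqP; rewrite subr_eq0 => /eqP xi.
  by rewrite vM ?oppr0 // inE -xi ltxx andbF.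
have F2 : \forall e \near 0^'+,
    0 <= (coord_sum R x - (k%:R - 1)) + e * coord_sum R v.
  apply: slack_near; first by rewrite subr_ge0 ltW.
  by move/eqP; rewrite subr_eq0 => /eqP s; rewrite s ltxx in lo.
have F3 : \forall e \near 0^'+,
    0 <= (k%:R - coord_sum R x) + e * - coord_sum R v.
  apply: slack_near; first by rewrite subr_ge0.
  by move/eqP; rewrite subr_eq0 => /eqP s; rewrite vt ?oppr0.
near (0 : R)^'+ => e; exists e; first by near: e; exact: nbhs_right_gt.
have G0 : forall i, 0 <= x 0 i + e * v 0 i by near: e.
have G1 : forall i, 0 <= (1 - x 0 i) + e * - v 0 i by near: e.
have G2 : 0 <= (coord_sum R x - (k%:R - 1)) + e * coord_sum R v by near: e.
have G3 : 0 <= (k%:R - coord_sum R x) + e * - coord_sum R v by near: e.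
split=> [i|]; first by rewrite !mxE G0 /=; have := G1 i; lra.
by rewrite coord_sumD coord_sumZ; split; lra.
Unshelve. all: by end_near. Qed.

Lemma has_dim_stratum x j : H x ->
  has_dim R (stratum (pattern x)) j <-> j = pattern_dim (pattern x).
Proof.
move=> Hx; have [Px _] := (half_openE x).1 Hx.
rewrite /pattern_dim -rank_direction; have [_ [xM xt]] := stratum_pattern Px.
apply: (has_dim_rank (x0 := x)); first exact: stratum_pattern.
  move=> y [_ [yM yt]]; apply/sub_directionP; split=> [i iM|t].
    by rewrite !mxE yM // xM // subrr.
  by rewrite coord_sumB yt // xt // subrr.
move=> v /sub_directionP[vM vt].
have [e e_gt0 Pe] : exists2 e : R, 0 < e & P (x + e *: v).
  by apply: perturb => // s; apply: vt; apply/eqP.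
exists e => //; split=> //; split=> [i iM|t].
  by rewrite !mxE vM // mulr0 addr0 xM.
by rewrite coord_sumD coord_sumZ vt // mulr0 addr0 xt.
Qed.

(* [x] can be pushed slightly beyond itself along [x - y]; validity of the
   inequality defining [F] at that point forces equality at [y]. *)
Lemma face_sub_stratum F x : is_face R P F -> F x -> H x ->
  stratum (pattern x) `<=` F.
Proof.
move=> [a [b [ab ->]]] [Px ax] Hx y [Py [yM yt]].
have [_ [xM xt]] := stratum_pattern Px.
split=> //=; apply/le_anti; rewrite ab //=.
have [i iM||e e_gt0 Pe] := @perturb x (x - y) Hx.
- by rewrite !mxE yM // xM // subrr.
- by move=> /eqP s; rewrite coord_sumB yt // xt // subrr.
have := ab _ Pe; rewrite dotpD dotpZ -scaleN1r dotpD dotpZ ax mulN1r.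
by rewrite gerDl pmulr_rle0 // subr_le0.
Qed.

Lemma stratum_face p : is_face R P (stratum p).
Proof.
case: p => [[M O] t].
(* The valid inequality is the sum of the tight ones; its slack is a sum of
   nonnegative slacks. *)
pose c i : R := if i \in M then 0 else if i \in O then 1 else -1.
pose b : R := \sum_i (if i \in M then 0 else (i \in O)%:R) + t%:R * k%:R.
pose a : 'rV[R]_n := \row_i (c i + t%:R).
have slackE x : P x -> b - dotp R a x =
    \sum_i (if i \in M then 0 else `|x 0 i - (i \in O)%:R|) +
    t%:R * (k%:R - coord_sum R x).
  move=> [x01 _].
  have -> : \sum_i (if i \in M then 0 else `|x 0 i - (i \in O)%:R|) =
            \sum_i (if i \in M then 0 else (i \in O)%:R) - \sum_i c i * x 0 i.
    rewrite -sumrB; apply: eq_bigr => i _; rewrite /c.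
    have /andP[x0 x1] := x01 i.
    case: (i \in M); first by rewrite mul0r subr0.
    case: (i \in O); last by rewrite subr0 ger0_norm // mulN1r opprK add0r.
    by rewrite ler0_norm ?subr_le0 // mul1r opprB.
  have -> : dotp R a x = \sum_i c i * x 0 i + t%:R * coord_sum R x.
    rewrite /coord_sum mulr_sumr -big_split; apply: eq_bigr => i _.
    by rewrite mxE mulrDl.
  by rewrite /b; ring.
have slack_ge0 (x : 'rV[R]_n) i :
    0 <= if i \in M then 0 else `|x 0 i - (i \in O)%:R|.
  by case: ifP.
have sum_slack_ge0 x : P x -> 0 <= t%:R * (k%:R - coord_sum R x).
  by move=> [_ [_ xk]]; rewrite mulr_ge0 ?ler0n // subr_ge0.
exists a, b; split=> [x Px|].
  by rewrite -subr_ge0 slackE // addr_ge0 ?sum_slack_ge0 ?sumr_ge0.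
apply/seteqP; split=> x [Px].
  move=> /= [xM xt]; split=> //; apply/esym/eqP; rewrite -subr_eq0 slackE //.
  rewrite big1 => [|i _]; last first.
    by case: ifPn => // iM; rewrite xM // subrr normr0.
  case: t xt {slackE sum_slack_ge0 a b} => [->//|_];
    by rewrite ?subrr ?mulr0 ?mul0r addr0.
move=> /esym/eqP; rewrite -subr_eq0 slackE //.
rewrite paddr_eq0 ?sum_slack_ge0 ?sumr_ge0 //.
move=> /andP[/eqP s0 /eqP tk]; split=> //; split=> /= [i iM|tT].
  have := psumr_eq0P (fun i _ => slack_ge0 x i) s0 (i := i) isT.
  by rewrite (negPf iM) => /eqP; rewrite normr_eq0 subr_eq0 => /eqP.
by move/eqP: tk; rewrite tT mul1r subr_eq0 => /eqP.
Qed.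

(** Each point lies in the stratum of the other, so whatever is tight at one is tight at the
    other. *)
Lemma pattern_inj_stratum x y : H x -> H y ->
  stratum (pattern x) `&` H = stratum (pattern y) `&` H ->
  pattern x = pattern y.
Proof.
have aux u w : H u -> stratum (pattern u) `&` H = stratum (pattern w) `&` H ->
  (forall i, i \notin free_coords w -> (i \notin free_coords u)
     && ((i \in one_coords u) == (i \in one_coords w))) /\
  (coord_sum R w == k%:R -> coord_sum R u == k%:R).
  move=> Hu E; have [Pu _] := (half_openE u).1 Hu.
  have /= [[_ [uM ut]] _] : (stratum (pattern w) `&` H) u.
    by rewrite -E; split=> //; exact: stratum_pattern.
  split=> [i iM|wk]; last by rewrite ut.
  rewrite !inE (uM i iM) inE; case: (w 0 i == 1) => /=.
    by rewrite ltxx andbF eqxx.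
  by rewrite ltxx [0 == 1]eq_sym oner_eq0.
move=> Hx Hy E; have [xM xt] := aux _ _ Hx E.
have [yM yt] := aux _ _ Hy (esym E).
have ME : free_coords x = free_coords y.
  apply/setP => i; apply/idP/idP; apply: contraTT.
    by move/xM/andP=> [].
  by move/yM/andP=> [].
have OE : one_coords x = one_coords y.
  apply/setP => i; have [iM|/xM/andP[_ /eqP //]] := boolP (i \in free_coords y).
  have := iM; rewrite -ME !inE => /andP[_ /lt_eqF ->].
  by move: iM; rewrite inE => /andP[_ /lt_eqF ->].
by rewrite /pattern ME OE; congr pair; apply/idP/idP.
Qed.

Lemma face_is_stratum F : is_face R P F -> F `&` H !=set0 ->
  exists2 x, H x & F = stratum (pattern x).
Proof.
move=> faceF [x0 [Fx0 Hx0]].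
(* A point of [F] with the fewest tight inequalities is relatively interior:
   averaging it with another point of [F] cannot lose a tight one. *)
pose mu x := (#|free_coords x| + (coord_sum R x != k%:R))%N.
pose attained m := `[< exists2 x, F x /\ H x & mu x = m >].
have [|m|_ /asboolP[x [Fx Hx] <-] max_x] := @ex_maxnP attained n.+1.
- by exists (mu x0); apply/asboolP; exists x0.
- move=> /asboolP[x _ <-]; rewrite -addn1 leq_add ?leq_b1 //.
  by rewrite -[leqRHS]card_ord max_card.
exists x => //; apply/seteqP; split; last exact: face_sub_stratum.
move=> y Fy; have [a [b [ab FE]]] := faceF.
have [Py ay] : P y /\ dotp R a y = b by move: Fy; rewrite FE.
have [Px ax] : P x /\ dotp R a x = b by move: Fx; rewrite FE.
pose z := 2^-1 *: x + 2^-1 *: y.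
have zE i : z 0 i = 2^-1 * x 0 i + 2^-1 * y 0 i by rewrite !mxE.
have zs : coord_sum R z = 2^-1 * coord_sum R x + 2^-1 * coord_sum R y.
  by rewrite coord_sumD !coord_sumZ.
have [x01 [xlo xhi]] := Hx; have [y01 [ylo yhi]] := Py.
(* The point [y] is only known to lie in [P]; the strict lower bound on the sum comes from [x]. *)
have Hz : H z.
  split=> [i|]; last by rewrite zs; split; lra.
  by rewrite zE; have := x01 i; have := y01 i; lra.
have Fz : F z.
  rewrite FE; split; first exact: ((half_openE z).1 Hz).1.
  by rewrite /= dotpD !dotpZ ax ay; lra.
have subM : free_coords x \subset free_coords z.
  apply/fintype.subsetP => i; rewrite !inE zE.
  by have := x01 i; have := y01 i; lra.
have subt : (coord_sum R x != k%:R <= (coord_sum R z != k%:R))%N.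
  have [//|xk] := eqVneq (coord_sum R x) k%:R.
  suff -> : coord_sum R z != k%:R by [].
  by rewrite lt_eqF // zs; move: xk; rewrite neq_lt; lra.
(* Maximality of [mu x] turns the inclusions [subM] and [subt] into equalities: [x] and [z] have the
   same tight inequalities. *)
have mu_z : (mu z <= mu x)%N by apply: max_x; apply/asboolP; exists z.
have le_card := subset_leq_card subM.
have cardE : #|free_coords x| = #|free_coords z|.
  by move: mu_z; rewrite /mu; lia.
have ME : free_coords x = free_coords z.
  by apply/eqP; rewrite eqEcard subM cardE leqnn.
have tE : (coord_sum R x != k%:R) = (coord_sum R z != k%:R).
  move: mu_z subt; rewrite /mu cardE; case: (_ != _); case: (_ != _);
    by rewrite ?addn0 ?addn1 ?ltnn.
(* A constraint tight at both [x] and the midpoint [z] is tight at [y], with the same fixed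
   value. *)
split=> //; split=> [i iM|/= /eqP xk].
  have := iM; rewrite /= [free_coords x]ME.
  move=> /(not_freeE ((half_openE z).1 Hz).1).
  have := not_freeE Px iM; rewrite zE.
  have := y01 i.
  by case: (i \in one_coords x); case: (i \in one_coords z) => /= *; lra.
by move: tE; rewrite xk eqxx /= => /esym/negbFE/eqP; rewrite zs xk; lra.
Qed.

(** Reduces counting faces to counting the patterns attained on [H]. *)
Lemma half_open_facesE j : half_open_faces R j n k =
  [set stratum p `&` H | p in
     [set p | exists2 x, H x & p = pattern x /\ pattern_dim p = j]].
Proof.
apply/seteqP; split=> [G [F [faceF [dimF [F0 ->]]]]|_ [_ [x Hx [-> <-]] <-]].
  have [x Hx FE] := face_is_stratum faceF F0.
  exists (pattern x); last by rewrite -FE.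
  exists x => //; split=> //; apply/esym/has_dim_stratum => //.
  by rewrite -FE.
exists (stratum (pattern x)); split; first exact: stratum_face.
split; first exact/has_dim_stratum.
split=> //; exists x; split=> //; apply: stratum_pattern.
exact: ((half_openE x).1 Hx).1.
Qed.

End Strata.

(** * Counting the patterns *)

Section Counting.
Variables n k j : nat.
Hypothesis j_gt0 : (0 < j)%N.
Implicit Types x : 'rV[R]_n.
Local Notation P := (hypersimplex R n k).
Local Notation H := (half_open_hypersimplex R n k).
Local Notation face_pattern := ({set 'I_n} * {set 'I_n} * bool)%type.

Lemma coord_sum_pattern x : P x ->
  coord_sum R x = #|one_coords x|%:R + \sum_(i in free_coords x) x 0 i.
Proof.
move=> Px; rewrite /coord_sum (bigID (mem (free_coords x))) /= addrC.
congr (_ + _); rewrite (eq_bigr (fun i => (i \in one_coords x)%:R)); last first.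
  by move=> i iM; apply: (not_freeE Px).
rewrite -natr_sum -sum1_card big_mkcond [in RHS]big_mkcond /=.
congr _%:R; apply: eq_bigr => i _; rewrite !inE.
by have [->|] := eqVneq (x 0 i) 1; [rewrite ltxx andbF|case: ifP].
Qed.

Lemma sum_free_bounds x : (0 < #|free_coords x|)%N ->
  0 < \sum_(i in free_coords x) x 0 i < #|free_coords x|%:R.
Proof.
move=> /card_gt0P[i0 i0M].
have bnd i : i \in free_coords x -> 0 < x 0 i < 1 by rewrite inE.
rewrite -sum1_card natr_sum; apply/andP; split.
  rewrite (bigD1 i0) //= ltr_pwDl //; first by have /andP[] := bnd _ i0M.
  by apply: sumr_ge0 => i /andP[/bnd /andP[/ltW]].
rewrite [ltLHS](bigD1 i0) // [ltRHS](bigD1 i0) //= ltr_leD //.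
  by have /andP[] := bnd _ i0M.
by apply: ler_sum => i /andP[/bnd /andP[_ /ltW]].
Qed.

Definition admissible : {set face_pattern} :=
  [set p : face_pattern |
     [&& p.1.2 \subset ~: p.1.1, #|p.1.1| == j + p.2
       & #|p.1.2| < k <= #|p.1.2| + j]%N]%SET.

(** The free coordinates add to [|O|] an amount strictly between 0 and [|M|]. Comparing the total
    with [k], or with the interval from [k - 1] to [k], yields the window for [k]. *)
Lemma pattern_admissible x : H x -> pattern_dim (pattern k x) = j ->
  pattern k x \in admissible.
Proof.
move=> Hx; have [Px lo] := (half_openE k x).1 Hx; have [_ [_ hi]] := Px.
rewrite /pattern_dim inE /= => dimE.
(* As [j > 0], the subtraction in [pattern_dim] is not truncated. *)
have M_card : #|free_coords x| = (j + (coord_sum R x == k%:R))%N.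
  by move: dimE j_gt0; case: (_ == _) => /=; lia.
have /sum_free_bounds /andP[s_gt0 s_lt] : (0 < #|free_coords x|)%N.
  by rewrite M_card; case: (_ == _); lia.
rewrite M_card eqxx /=; apply/and3P; split.
- apply/fintype.subsetP => i; rewrite !inE => /eqP ->.
  by rewrite ltxx andbF.
- rewrite -(ltr_nat R) (lt_le_trans _ hi) // (coord_sum_pattern Px).
  by rewrite ltrDl.
move: s_lt lo; rewrite M_card; case: eqP => [sk s_lt _|_ s_lt lo].
  rewrite -ltnS -(ltr_nat R) -sk (coord_sum_pattern Px).
  rewrite -addnS -[j.+1]addn1 natrD.
  by rewrite ltrD2l.
rewrite -ltnS -(ltr_nat R) -[(_ + j).+1%:R]natr1 natrD -ltrBlDr.
by rewrite (lt_trans lo) // (coord_sum_pattern Px) ltrD2l -[j]addn0.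
Qed.

Lemma admissible_pattern p : p \in admissible ->
  exists2 x, H x & p = pattern k x /\ pattern_dim p = j.
Proof.
case: p => [[M O] t]; rewrite inE /= => /and3P[OM /eqP Mcard /andP[Ok kO]].
(* The witness has all free coordinates equal to [c], chosen to make the coordinate sum [s]; without
   the sum constraint, [s] is the midpoint of the allowed interval. The window for [k] gives
   [0 < c < 1]. *)
pose s : R := if t then k%:R else k%:R - 2^-1.
pose c : R := (s - #|O|%:R) / #|M|%:R.
have M_gt0 : 0 < #|M|%:R :> R by rewrite ltr0n Mcard addn_gt0 j_gt0.
have Ok' : #|O|%:R + 1 <= k%:R :> R by rewrite natr1 ler_nat.
have kO' : k%:R <= #|O|%:R + j%:R :> R by rewrite -natrD ler_nat.
have Mcard' : #|M|%:R = j%:R + t%:R :> R by rewrite Mcard natrD.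
have c_gt0 : 0 < c.
  by rewrite divr_gt0 // subr_gt0 /s; case: (t); lra.
have c_lt1 : c < 1.
  by rewrite ltr_pdivrMr // mul1r Mcard' /s; case: (t) => /=; lra.
pose x : 'rV[R]_n := \row_i (if i \in M then c else (i \in O)%:R).
have ME : free_coords x = M.
  apply/setP => i; rewrite inE mxE; case: (i \in M); first by rewrite c_gt0.
  by case: (i \in O); rewrite ?ltxx ?andbF.
have OE : one_coords x = O.
  apply/setP => i; rewrite inE mxE.
  case: ifPn => [iM|iM]; last first.
    by case: (i \in O); rewrite ?eqxx // eq_sym oner_eq0.
  rewrite lt_eqF //; apply/esym/negbTE; apply/negP => /(fintype.subsetP OM).
  by rewrite inE iM.
have xs : coord_sum R x = s.
  rewrite /coord_sum (bigID (mem M)) /=.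
  rewrite (eq_bigr (fun=> c)) => [|i iM]; last by rewrite mxE iM.
  rewrite sumr_const -mulr_natr divfK ?gt_eqF //.
  rewrite (eq_bigr (fun i => (i \in O)%:R)) => [|i /negPf iM]; last first.
    by rewrite mxE iM.
  rewrite -natr_sum (_ : (\sum_(i | i \notin M) (i \in O))%N = #|O|) ?subrK //.
  rewrite -sum1_card big_mkcond [RHS]big_mkcond; apply: eq_bigr => i _ /=.
  have := fintype.subsetP OM i; rewrite inE.
  by case: (i \in M); case: (i \in O) => // /(_ isT).
exists x; last first.
  split; last by rewrite /pattern_dim /= Mcard addnK.
  rewrite /pattern ME OE xs /s; congr pair; case: (t); first by rewrite eqxx.
  by apply/esym/negbTE; rewrite lt_eqF //; lra.
split=> [i|]; last by rewrite xs /s; case: (t); split; lra.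
rewrite mxE; case: ifP => _; first by rewrite !ltW.
by case: (i \in O); rewrite /= ?lexx ?ler01.
Qed.

End Counting.

(** * Cardinality of the set of faces and summation over [k] *)

Lemma fcountE (T : Type) (S : set T) (N : nat) :
  (S #= `I_N)%card -> fcount S = N.
Proof.
move=> SN; apply: xget_unique => // m Sm.
by apply/card_eq_II; apply: card_eq_trans SN; rewrite card_eq_sym.
Qed.

Lemma card_eq_image_finset (T : finType) (U : Type) (A : {set T}) (f : T -> U) :
  {in A &, injective f} -> (f @` [set` A] #= `I_#|A|)%card.
Proof.
move=> f_inj.
have [A0|[a0 a0A]] := set_0Vmem A.
  rewrite A0 finset.cards0 II0.
  rewrite (_ : [set` _] = classical_sets.set0) ?image_set0 //.
  by apply/seteqP; split=> x //=; rewrite inE.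
have nthA i : `I_#|A| i -> nth a0 (enum A) i \in A.
  by move=> /= iA; rewrite -mem_enum mem_nth // -cardE.
rewrite (_ : f @` _ = (fun i => f (nth a0 (enum A) i)) @` `I_#|A|); last first.
  apply/seteqP; split=> [_ [x /= xA <-]|_ [i iA <-]]; last first.
    by exists (nth a0 (enum A) i) => //; exact: nthA.
  exists (index x (enum A)); last by rewrite nth_index ?mem_enum.
  by rewrite /= cardE index_mem mem_enum.
apply: inj_card_eq => i l; rewrite !inE => iA lA /f_inj E.
apply/eqP; rewrite -(nth_uniq a0 _ _ (enum_uniq A)) -?cardE //.
by apply/eqP/E; exact: nthA.
Qed.

Lemma finite_half_open_faces j n k : finite_set (half_open_faces R j n k).
Proof.
rewrite half_open_facesE; apply: finite_image.
exact: (sub_finite_set (@subsetT _ _)).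
Qed.

(** Intersecting strata with [H] is a bijection from admissible patterns to half-open [j]-faces. *)
Lemma fj_admissible j n k : (0 < j)%N -> fj R j n k = #|admissible n k j|.
Proof.
move=> j_gt0; apply: fcountE; rewrite half_open_facesE.
rewrite (_ : [set p | _] = [set` admissible n k j]); last first.
  apply/seteqP; split=> [_ [x Hx [-> dimE]]|p /=].
    exact: pattern_admissible.
  exact: admissible_pattern.
apply: card_eq_image_finset => p q.
move=> /(admissible_pattern j_gt0)[x Hx [-> _]].
move=> /(admissible_pattern j_gt0)[y Hy [-> _]].
exact: pattern_inj_stratum.
Qed.

(** Counts the values of [k] compatible with a set [O] of size [a]; the minimum is [j] once the
    window fits below [N]. *)
Lemma sum_window a j N :
  (\sum_(1 <= k < N.+1) (a < k <= a + j) = minn (N - a) j)%N.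
Proof.
elim: N => [|N IH]; first by rewrite big_geq ?sub0n ?min0n.
by rewrite big_nat_recr //= IH; lia.
Qed.

(** Choose the first set, then any subset of its complement. *)
Lemma card_disjoint_pairs n m :
  (\sum_(q : {set 'I_n} * {set 'I_n} | (#|q.1| == m) && (q.2 \subset ~: q.1)) 1
   = 'C(n, m) * 2 ^ (n - m))%N.
Proof.
rewrite -(pair_big_dep (fun M : {set 'I_n} => #|M| == m)
            (fun M O : {set 'I_n} => O \subset ~: M) (fun _ _ => 1%N)) /=.
rewrite (eq_bigr (fun=> 2 ^ (n - m))%N) => [|M /eqP Mm].
  by rewrite sum_nat_cond_const card_draws card_ord.
rewrite sum1dep_card -/(powerset (~: M)) card_powerset.
by rewrite cardsCs finset.setCK card_ord Mm.
Qed.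

Lemma sum_fj n j : (0 < j)%N ->
  (\sum_(1 <= k < n.+1) fj R j n k =
   j * ('C(n, j) * 2 ^ (n - j) + 'C(n, j.+1) * 2 ^ (n - j.+1)))%N.
Proof.
move=> j_gt0.
pose Q (p : {set 'I_n} * {set 'I_n} * bool) :=
  (p.1.2 \subset ~: p.1.1) && (#|p.1.1| == j + p.2)%N.
transitivity (\sum_(1 <= k < n.+1) \sum_(p | Q p)
                (#|p.1.2| < k <= #|p.1.2| + j))%N.
  apply: eq_bigr => k _; rewrite fj_admissible // -sum1_card.
  rewrite [in RHS]big_mkcond [in LHS]big_mkcond; apply: eq_bigr => p _.
  by rewrite inE andbA -/(Q p); case: (Q p).
rewrite exchange_big /=.
rewrite (eq_bigr (fun=> j)) => [|[[M O] t] /andP[/= OM /eqP Mj]].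
  rewrite sum_nat_cond_const mulnC; congr (_ * _)%N.
  (* Split on the Boolean: [false] leaves the pairs with [|M| = j], [true] those with
     [|M| = j + 1]. *)
  rewrite -sum1dep_card.
  rewrite -(pair_big_dep (fun q : {set 'I_n} * {set 'I_n} => q.2 \subset ~: q.1)
     (fun q (t : bool) => #|q.1| == j + t)%N (fun _ _ => 1%N)) /=.
  rewrite (exchange_big_dep xpredT) //= big_bool /=.
  under eq_bigl do rewrite andbC.
  under [in X in (_ + X)%N]eq_bigl do rewrite andbC.
  by rewrite !card_disjoint_pairs addn0 addn1 addnC.
(* Since [O] avoids [M], [|O| + j <= |O| + |M| <= n], so the window is not cut off. *)
rewrite sum_window /=; apply/minn_idPr.
have leO := subset_leq_card OM.
have := cardsC M; rewrite card_ord Mj => nE.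
apply: (@leq_trans (j + t + #|~: M| - #|O|)); last by rewrite nE.
by rewrite -addnBA // -addnA leq_addr.
Qed.

End Geometry.

(** * Closed form and generating function *)

Lemma binomial_weight (n j : nat) :
  ('C(n, j) * 2 ^ (n - j) * 2 ^ j = 'C(n, j) * 2 ^ n)%N.
Proof.
(* For [j > n] the exponent [n - j] is truncated, but the binomial coefficient vanishes. *)
have [le_jn|lt_nj] := leqP j n; last by rewrite bin_small.
by rewrite -mulnA -expnD subnK.
Qed.

Theorem theorem2p3 (R : realType) :
  (forall j n k : nat, finite_set (half_open_faces R j n k)) /\
  (forall n j : nat, (1 <= j <= n)%N ->
     ((\sum_(1 <= k < n.+1) fj R j n k)%N)%:R =
       j%:R * (2%:R : R) ^ (n%:Z - j%:Z - 1) * ((n + j + 2)%N%:R / (n.+1)%:R)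
       * ('C(n.+1, j.+1))%:R) /\
  (forall j : nat, (1 <= j)%N -> forall x : R, `|x| < 2^-1 ->
     (fun N : nat => \sum_(1 <= n < N) ((\sum_(1 <= k < n.+1) fj R j n k)%N)%:R * x ^+ n)
       @ \oo --> (j%:R * x ^+ j * (1 - x) / (1 - 2%:R * x) ^+ (j + 2) : R)).
Proof.
split; first exact: finite_half_open_faces.
split=> [n j /andP[j_gt0 le_jn]|j j_gt0 x x_lt].
  rewrite sum_fj // -!mulrA natrM; congr (_ * _).
  have diag : (n.+1%:R : R) * 'C(n, j)%:R = j.+1%:R * 'C(n.+1, j.+1)%:R.
    by rewrite -!natrM mul_bin_diag.
  have n1 : n.+1%:R != 0 :> R by rewrite pnatr_eq0.
  (* By Pascal's rule the right side is [C(n+1, j+1) + C(n, j)]; multiplying by [n + 1] and using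
     [diag] gives the factor [(n + 1) + (j + 1)]. *)
  have -> : (n + j + 2)%N%:R * (n.+1%:R^-1 * 'C(n.+1, j.+1)%:R) =
            2 * 'C(n, j)%:R + 'C(n, j.+1)%:R :> R.
    apply: (mulfI n1); rewrite mulrCA mulVKf // mulrDr mulrCA diag.
    have pascal : 'C(n.+1, j.+1)%:R = 'C(n, j.+1)%:R + 'C(n, j)%:R :> R.
      by rewrite binS natrD.
    have -> : 'C(n, j.+1)%:R = 'C(n.+1, j.+1)%:R - 'C(n, j)%:R :> R.
      by rewrite pascal addrK.
    by rewrite mulrBr diag -addn1 -[n.+1]addn1 -[j.+1]addn1 !natrD; ring.
  (* For [j = n] the exponent [n - j - 1] is [-1], so this case leaves the natural powers and is
     treated apart. *)
  move: le_jn; rewrite leq_eqVlt => /orP[/eqP ->|lt_jn].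
    rewrite subnn binn (@bin_small n n.+1) // mul0n addn0 subrr sub0r addr0.
    by rewrite exprN1 mulr1 mulVf ?pnatr_eq0.
  have -> : n%:Z - j%:Z - 1 = (n - j.+1)%N :> int by lia.
  rewrite -exprnP natrD !natrM !natrX -[(n - j)%N]prednK ?subn_gt0 // exprS.
  by rewrite -subnS; ring.
have y_lt : `|2 * x| < 1 by rewrite normrM normr_nat; lra.
(* Since [2^(n-i) x^n = 2^(-i) (2x)^n], the partial sums combine two binomial series at [2 * x]. *)
have -> : (fun N => \sum_(1 <= n < N)
             ((\sum_(1 <= k < n.+1) fj R j n k)%N)%:R * x ^+ n) =
  (fun N => j%:R * (2 ^- j * (\sum_(0 <= n < N) 'C(n, j)%:R * (2 * x) ^+ n) +
     2 ^- j.+1 * (\sum_(0 <= n < N) 'C(n, j.+1)%:R * (2 * x) ^+ n))).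
  apply/funext => -[|N]; first by rewrite !big_geq // !mulr0 addr0 mulr0.
  (* The terms at [n = 0] vanish because [j > 0]. *)
  rewrite [\sum_(0 <= n < N.+1) 'C(n, j)%:R * _]big_ltn //.
  rewrite [\sum_(0 <= n < N.+1) 'C(n, j.+1)%:R * _]big_ltn //.
  rewrite !bin_small // !mul0r !add0r !mulr_sumr -big_split mulr_sumr.
  apply: eq_bigr => n _; rewrite sum_fj // natrM natrD.
  have weight i :
      ('C(n, i) * 2 ^ (n - i))%:R = 2 ^- i * ('C(n, i)%:R * 2 ^+ n) :> R.
    have two_i : 2 ^+ i != 0 :> R by rewrite expf_neq0 ?pnatr_eq0.
    apply: (mulfI two_i); rewrite mulVKf // -!natrX -!natrM mulnC.
    by rewrite binomial_weight.
  by rewrite !weight exprMn /=; ring.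
have two_j : 2 ^+ j != 0 :> R by rewrite expf_neq0 ?pnatr_eq0.
have x1 : 1 - 2 * x != 0.
  by rewrite subr_eq0 gt_eqF // (le_lt_trans (ler_norm _)).
(* Powers of 2 cancel, and [1 - x = (1 - 2x) + x] splits the fraction into the two limits. *)
have -> : j%:R * x ^+ j * (1 - x) / (1 - 2 * x) ^+ (j + 2) =
  j%:R * (2 ^- j * ((2 * x) ^+ j / (1 - 2 * x) ^+ j.+1) +
          2 ^- j.+1 * ((2 * x) ^+ j.+1 / (1 - 2 * x) ^+ j.+2)).
  rewrite addn2 !exprMn ![_ ^+ j.+2]exprS ![_ ^+ j.+1]exprS.
  by field; rewrite two_j x1 expf_neq0.
apply: cvgMr; apply: cvgD; apply: cvgMr; exact: cvg_binomial_series.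
Qed.
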